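(* Let $d\in\mathbb{N}$ and let $f(s)=\sum_{k=1}^\infty a_kk^{-s}\in\mathcal{D}_d$, that is, $f$ is a convergent Dirichlet series depending only on $d$ given primes. Let $n\in\mathbb{N}$. If $f^n\in\mathrm{Bloch}(\mathbb{C}_+)$, then $f^m\in\mathrm{Bloch}(\mathbb{C}_+)$ for all integers $1\le m\le n$.
   Context: A convergent Dirichlet series is a series $\sum_{k\ge1}a_kk^{-s}$ which converges in some half-plane. It depends only on $d$ given primes if there is a set of $d$ primes such that $a_k=0$ whenever $k$ has a prime factor outside this set; $\mathcal{D}_d$ denotes the set of such series. $\mathbb{C}_+=\{s\in\mathbb{C}:\mathrm{Re}(s)>0\}$. $\mathrm{Bloch}(\mathbb{C}_+)$ is the space of analytic functions $u$ on $\mathbb{C}_+$ such that $\sup_{\sigma>0,\,t\in\mathbb{R}}\sigma|u'(\sigma+it)|<\infty$; a Dirichlet series is identified with its analytic extension. $f^m$ denotes the $m$-th power (pointwise product).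
   Formalization: It is assumed that f itself, not only f^n, extends analytically to C_+; otherwise the claim fails, e.g. f(s)=(1-2·2^{-s})^{1/2} with n=2, m=1, where f^2 is in Bloch(C_+) but f has a branch point at s=1. *)

(* Defs.v *)
From Stdlib Require Export Reals Arith List Znumtheory.
From Coquelicot Require Export Coquelicot.

Open Scope R_scope.

Definition Cexp (z : C) : C :=
  (exp (Re z) * cos (Im z), exp (Re z) * sin (Im z)).

(** [k^(-s)]; meaningful only for [1 <= k]. *)
Definition nat_cpow_opp (k : nat) (s : C) : C :=
  Cexp (Copp (Cmult s (RtoC (ln (INR k))))).

(** Coefficients [a : nat -> C] are those of [sum_(k >= 1) a k * k^(-s)]; the
    library's series start at [0], hence the shift, and [a 0] is never used. *)
Definition dirichlet_term (a : nat -> C) (s : C) (j : nat) : C :=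
  Cmult (a (S j)) (nat_cpow_opp (S j) s).

Definition is_dirichlet_series (a : nat -> C) (s l : C) : Prop :=
  @is_series C_AbsRing C_NormedModule (dirichlet_term a s) l.

Definition convergent_dirichlet_series (a : nat -> C) : Prop :=
  exists sigma0 : R, forall s : C, sigma0 < Re s ->
    exists l : C, is_dirichlet_series a s l.

Definition nat_prime (p : nat) : Prop := prime (Z.of_nat p).

Definition depends_only_on (P : list nat) (a : nat -> C) : Prop :=
  forall k : nat, (1 <= k)%nat ->
    (exists p : nat, nat_prime p /\ Nat.divide p k /\ ~ In p P) ->
    a k = RtoC 0.

(** The class [D_d], as a predicate on coefficient sequences. *)
Definition dirichlet_class (d : nat) (a : nat -> C) : Prop :=
  convergent_dirichlet_series a /\
  exists P : list nat,
    NoDup P /\ length P = d /\ (forall p, In p P -> nat_prime p) /\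
    depends_only_on P a.

(** Functions on the right half-plane [C_+] are represented by total functions
    [C -> C] whose values outside [C_+] are irrelevant. *)
Definition analytic_on_right_half_plane (u : C -> C) : Prop :=
  forall s : C, 0 < Re s -> @ex_derive C_AbsRing C_NormedModule u s.

(** [f] is the function on [C_+] with which the Dirichlet series is identified.
    [sigma0] is existentially quantified since the series itself need not
    converge in all of [C_+]. *)
Definition analytic_extension (a : nat -> C) (f : C -> C) : Prop :=
  analytic_on_right_half_plane f /\
  exists sigma0 : R, forall s : C, 0 < Re s -> sigma0 < Re s ->
    is_dirichlet_series a s (f s).

Definition Bloch (u : C -> C) : Prop :=
  analytic_on_right_half_plane u /\
  exists M : R, forall sigma t : R, 0 < sigma ->
    sigma * Cmod (C_derive u (sigma, t)) <= M.

(* Main.v *)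
Require Import Defs.
From Stdlib Require Import Lra Lia Classical ClassicalEpsilon.

(* The argument is local and uses no Dirichlet series, only that [f] is
   holomorphic on the half-plane.  Let [sigma |(f^n)'| <= M].  Where [|f s| > 1],
   [m |f|^(m-1) |f'| <= m n |f|^(n-1) |f'|].  Where [|f s| <= 1], the Bloch bound
   makes [f^n] vary by at most [4 M] on the disc of radius [sigma / 2] about [s],
   so [f] is bounded there and Cauchy's estimate gives [sigma |f' s| <= 4 + 8 M].
   As holomorphy is mere pointwise differentiability, Cauchy's estimate is
   obtained by Goursat's bisection: in polar coordinates about [s],
   [(f z - f s) / (z - s)] has a circular mean independent of the radius, and this
   mean tends to [f' s] as the radius shrinks. *)

(** * Complex derivatives and real differentials *)

(** The product rule [is_derive_mult] lives on the second module structure. The small-o estimate is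
    the same in both; only the linearity of the differential is proved anew. *)
Lemma is_derive_C_iff (f : C -> C) (z l : C) :
  @is_derive C_AbsRing C_NormedModule f z l <->
  @is_derive C_AbsRing (AbsRing_NormedModule C_AbsRing) f z l.
Proof.
split; intros [_ H]; (split; [apply is_linear_scal_l | exact H]).
Qed.

Lemma is_derive_C_small_o (f : C -> C) (z l : C) (eps : posreal) :
  @is_derive C_AbsRing C_NormedModule f z l ->
  exists delta : posreal, forall w : C, Cmod (w - z) < delta ->
    Cmod (f w - f z - (w - z) * l) <= eps * Cmod (w - z).
Proof.
intros [_ H].
destruct (H z (fun P HP => HP) eps) as [delta Hd].
exists delta; intros w Hw; exact (Hd w Hw).
Qed.

Lemma is_derive_Cpow (f : C -> C) (z l : C) (n : nat) :
  @is_derive C_AbsRing C_NormedModule f z l ->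
  @is_derive C_AbsRing C_NormedModule (fun s => Cpow (f s) n) z
    (INR n * Cpow (f z) (pred n) * l)%C.
Proof.
intros H; induction n as [|n IH].
- simpl.   replace (RtoC 0 * 1 * l)%C with (@zero C_NormedModule).
  + apply (@is_derive_const C_AbsRing C_NormedModule).
  + change (RtoC 0 = RtoC 0 * 1 * l)%C; ring.
- apply is_derive_C_iff.
  apply is_derive_C_iff in H; apply is_derive_C_iff in IH.
  pose proof (is_derive_mult _ _ _ _ _ H IH Cmult_comm) as D.
  change (@is_derive C_AbsRing (AbsRing_NormedModule C_AbsRing) (fun s => f s * Cpow (f s) n)%C z
     (l * Cpow (f z) n + f z * (INR n * Cpow (f z) (pred n) * l))%C) in D.
  replace (INR (S n) * Cpow (f z) (pred (S n)) * l)%C with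
     (l * Cpow (f z) n + f z * (INR n * Cpow (f z) (pred n) * l))%C; [exact D|].
  rewrite S_INR, RtoC_plus; destruct n; simpl; ring.
Qed.

(** The real differential of [f] is multiplication by [l]. It is a joint differential, not merely a
    pair of partial derivatives, as Goursat's argument requires. *)
Lemma Cauchy_Riemann (f : C -> C) (x y : R) (l : C) :
  @is_derive C_AbsRing C_NormedModule f (x, y) l ->
  differentiable_pt_lim (fun u v => Re (f (u, v))) x y (Re l) (- Im l) /\
  differentiable_pt_lim (fun u v => Im (f (u, v))) x y (Im l) (Re l).
Proof.
intros H.
assert (D : forall eps : posreal, locally_2d (fun u v : R =>
  Cmod (f (u, v) - f (x, y) - ((u, v) - (x, y)) * l) <=
  eps * Rmax (Rabs (u - x)) (Rabs (v - y))) x y).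
{ intros eps.
  (* [locally_2d] uses the max norm; passing to it from the modulus costs a factor [sqrt 2 <= 2], so
     both [eps] and [delta] are halved. *)
  assert (He : 0 < eps / 2) by (destruct eps; simpl; lra).
  destruct (is_derive_C_small_o f (x, y) l (mkposreal _ He) H) as [delta Hd].
  assert (Hd2 : 0 < delta / 2) by (destruct delta; simpl; lra).
  assert (S2 : sqrt 2 <= 2).
  { rewrite <- (sqrt_square 2) at 2; [apply sqrt_le_1|]; lra. }
  exists (mkposreal _ Hd2); simpl; intros u v Hu Hv.
  assert (Hm : Cmod ((u, v) - (x, y)) <= 2 * Rmax (Rabs (u - x)) (Rabs (v - y))).
  { eapply Rle_trans; [apply Cmod_2Rmax|].
    apply Rmult_le_compat_r; [|exact S2].
    eapply Rle_trans; [apply Rabs_pos | apply Rmax_l]. }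
  eapply Rle_trans.
  - apply Hd. eapply Rle_lt_trans; [exact Hm|].
    apply (Rmax_lub_lt _ _ _ Hu) in Hv. lra.
  - simpl. destruct eps as [e e0]; simpl in *. nra. }
split; intros eps; destruct (D eps) as [delta Hd]; exists delta;
  intros u v Hu Hv; (eapply Rle_trans; [|apply (Hd u v Hu Hv)]);
  (eapply Rle_trans; [|apply Rmax_Cmod]).
- eapply Rle_trans; [|apply Rmax_l]. right; f_equal.
  unfold Cminus, Cplus, Copp, Cmult, Re, Im; simpl; ring.
- eapply Rle_trans; [|apply Rmax_r]. right; f_equal.
  unfold Cminus, Cplus, Copp, Cmult, Re, Im; simpl; ring.
Qed.

Lemma differentiable_pt_lim_is_derive (f : R -> R -> R) (x y lx ly : R) :
  differentiable_pt_lim f x y lx ly ->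
  is_derive (fun u => f u y) x lx /\ is_derive (fun v => f x v) y ly.
Proof.
intros H; split; apply is_derive_Reals.
- replace lx with (lx * 1 + ly * 0) by ring.
  apply (derivable_pt_lim_comp_2d f (fun u => u) (fun _ => y));
    [exact H | apply derivable_pt_lim_id | apply derivable_pt_lim_const].
- replace ly with (lx * 0 + ly * 1) by ring.
  apply (derivable_pt_lim_comp_2d f (fun _ => x) (fun v => v));
    [exact H | apply derivable_pt_lim_const | apply derivable_pt_lim_id].
Qed.

Lemma differentiable_pt_lim_continuous (f : R -> R -> R) (x y lx ly : R) :
  differentiable_pt_lim f x y lx ly ->
  continuous (fun u => f u y) x /\ continuous (fun v => f x v) y.
Proof.
intros H; apply differentiable_pt_lim_is_derive in H as [H1 H2].
split; apply @ex_derive_continuous; eexists; eassumption.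
Qed.

(** * Bisection of rectangles *)

Lemma half_pow_archimed (W delta : R) : 0 < delta -> exists n : nat, W / 2 ^ n < delta.
Proof.
intros Hd.
destruct (Pow_x_infinity 2 ltac:(rewrite Rabs_right; lra) ((Rabs W + 1) / delta)) as [N HN].
exists N. specialize (HN N (le_n N)).
assert (0 < 2 ^ N) by (apply pow_lt; lra).
rewrite Rabs_right in HN by lra.
apply Rlt_div_l; [lra|].
apply Rge_le, Rle_div_l in HN; [|lra].
pose proof (Rle_abs W); lra.
Qed.

(* [B a b c d] is a property of the rectangle [a, b] x [c, d]. *)
Lemma quadrisection (B : R -> R -> R -> R -> Prop) (a b c d : R) :
  a <= b -> c <= d -> B a b c d ->
  (forall a b c d, a <= b -> c <= d -> B a b c d ->
     let p := (a + b) / 2 in let q := (c + d) / 2 in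
     B a p c q \/ B p b c q \/ B a p q d \/ B p b q d) ->
  exists x y, a <= x <= b /\ c <= y <= d /\
    forall delta, 0 < delta -> exists a' b' c' d',
      B a' b' c' d' /\ a <= a' <= x /\ x <= b' <= b /\ c <= c' <= y /\ y <= d' <= d /\
      b' - a' < delta /\ d' - c' < delta.
Proof.
intros Hab Hcd HB Hstep.
pose (halfI := fun (l r l' r' : R) => l <= l' /\ l' <= r' /\ r' <= r /\ r' - l' = (r - l) / 2).
(* Rectangles with property [B] form a subtype, so that the choice of a quarter becomes a function
   [next] on [T], which can be iterated. *)
pose (T := {t : R * R * (R * R) | fst (fst t) <= snd (fst t) /\ fst (snd t) <= snd (snd t) /\
   B (fst (fst t)) (snd (fst t)) (fst (snd t)) (snd (snd t))}).
assert (next : forall t : T, {t' : T |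
  halfI (fst (fst (proj1_sig t))) (snd (fst (proj1_sig t)))
        (fst (fst (proj1_sig t'))) (snd (fst (proj1_sig t'))) /\
  halfI (fst (snd (proj1_sig t))) (snd (snd (proj1_sig t)))
        (fst (snd (proj1_sig t'))) (snd (snd (proj1_sig t')))}).
{ intros [[[l r] [l2 r2]] [H1 [H2 H3]]]; simpl in *.
  apply constructive_indefinite_description; unfold halfI.
  destruct (Hstep l r l2 r2 H1 H2 H3) as [K|[K|[K|K]]]; simpl in K.
  - unshelve eexists. { exists (l, (l + r) / 2, (l2, (l2 + r2) / 2)); simpl; repeat split; [lra|lra|exact K]. }
    simpl; lra.
  - unshelve eexists. { exists ((l + r) / 2, r, (l2, (l2 + r2) / 2)); simpl; repeat split; [lra|lra|exact K]. }
    simpl; lra.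
  - unshelve eexists. { exists (l, (l + r) / 2, ((l2 + r2) / 2, r2)); simpl; repeat split; [lra|lra|exact K]. }
    simpl; lra.
  - unshelve eexists. { exists ((l + r) / 2, r, ((l2 + r2) / 2, r2)); simpl; repeat split; [lra|lra|exact K]. }
    simpl; lra. }
assert (t0 : {t : T | proj1_sig t = (a, b, (c, d))}).
{ unshelve eexists; [exists (a, b, (c, d)); simpl; auto|reflexivity]. }
destruct t0 as [t0 Ht0].
pose (t := nat_rect (fun _ => T) t0 (fun _ s => proj1_sig (next s))).
assert (nest : forall u v : nat -> R, u 0%nat <= v 0%nat ->
  (forall n, halfI (u n) (v n) (u (S n)) (v (S n))) ->
  exists x, forall n, u 0%nat <= u n <= x /\ x <= v n <= v 0%nat /\
     v n - u n = (v 0%nat - u 0%nat) / 2 ^ n).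
{ intros u v H0 Hs.
  assert (W : forall n, u n <= v n /\ u 0%nat <= u n /\ v n <= v 0%nat /\
                v n - u n = (v 0%nat - u 0%nat) / 2 ^ n).
  { induction n as [|n IH]; [simpl; lra|].
    destruct (Hs n) as (h1 & h2 & h3 & h4).
    repeat split; try lra.
    rewrite h4. destruct IH as (_ & _ & _ & ->). simpl. field. apply pow_nonzero; lra. }
  assert (M : forall n k, u n <= u (n + k)%nat /\ v (n + k)%nat <= v n).
  { intros n; induction k as [|k IH]; [rewrite Nat.add_0_r; lra|].
    rewrite Nat.add_succ_r. destruct (Hs (n + k)%nat) as (h1 & h2 & h3 & h4). lra. }
  destruct (completeness (fun r => exists n, r = u n)) as [x [Hx1 Hx2]].
  - exists (v 0%nat); intros r [n ->]. destruct (W n); lra.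
  - exists (u 0%nat), 0%nat; reflexivity.
  - exists x; intros n. destruct (W n) as (w1 & w2 & w3 & w4).
    assert (u n <= x) by (apply Hx1; exists n; reflexivity).
    assert (x <= v n).
    (* Every lower end [u k] lies below every upper end [v n]: compare both at the common index
       [n + k]. *)
    { apply Hx2; intros r [k ->].
      pose proof (M n k); pose proof (M k n); pose proof (W (n + k)%nat) as Q.
      rewrite (Nat.add_comm k n) in *. lra. }
    lra. }
destruct (nest (fun n => fst (fst (proj1_sig (t n)))) (fun n => snd (fst (proj1_sig (t n)))))
  as [x Hx].
{ simpl; rewrite Ht0; exact Hab. }
{ intros n; apply (proj2_sig (next (t n))). }
destruct (nest (fun n => fst (snd (proj1_sig (t n)))) (fun n => snd (snd (proj1_sig (t n)))))
  as [y Hy].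
{ simpl; rewrite Ht0; exact Hcd. }
{ intros n; apply (proj2_sig (next (t n))). }
simpl in Hx, Hy. rewrite Ht0 in Hx, Hy; simpl in Hx, Hy.
exists x, y; repeat split;
  [destruct (Hx 0%nat); lra|destruct (Hx 0%nat); lra|destruct (Hy 0%nat); lra|destruct (Hy 0%nat); lra|].
intros delta Hd.
(* Taking the sum of width and height makes one [n] serve for both sides. *)
destruct (half_pow_archimed (b - a + (d - c)) delta Hd) as [n Hn].
specialize (Hx n); specialize (Hy n).
pose proof (proj2_sig (t n)) as (_ & _ & K).
exists (fst (fst (proj1_sig (t n)))), (snd (fst (proj1_sig (t n)))),
  (fst (snd (proj1_sig (t n)))), (snd (snd (proj1_sig (t n)))).
rewrite Rdiv_plus_distr in Hn.
assert (0 <= (b - a) / 2 ^ n) by lra.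
assert (0 <= (d - c) / 2 ^ n) by lra.
split; [exact K|]. lra.
Qed.

(** * Goursat's lemma on rectangles *)

(** The line integral of [P dx + Q dy] counterclockwise around the rectangle, with opposite edges
    paired in one integrand. *)
Definition boundary_int (P Q : R -> R -> R) (a b c d : R) : R :=
  RInt (fun x => P x c - P x d) a b + RInt (fun y => Q b y - Q a y) c d.

Lemma RInt_minus_R (f g : R -> R) (a b : R) :
  ex_RInt f a b -> ex_RInt g a b ->
  RInt (fun x => f x - g x) a b = RInt f a b - RInt g a b.
Proof. exact (RInt_minus f g a b). Qed.

Lemma RInt_Chasles_R (f : R -> R) (a b c : R) :
  ex_RInt f a b -> ex_RInt f b c -> RInt f a c = RInt f a b + RInt f b c.
Proof. intros H1 H2; symmetry; exact (RInt_Chasles f a b c H1 H2). Qed.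

Section Rectangle.

Variables (P Q : R -> R -> R) (a b c d : R).
(** The shared [k] expresses closedness: the [y]-derivative of [P] equals the [x]-derivative of
    [Q]. *)
Hypothesis closed : forall x y, a <= x <= b -> c <= y <= d ->
  exists px k qy, differentiable_pt_lim P x y px k /\ differentiable_pt_lim Q x y k qy.

Lemma ex_RInt_slice_x (y l r : R) :
  a <= l <= r -> r <= b -> c <= y <= d -> ex_RInt (fun x => P x y) l r.
Proof.
intros; apply @ex_RInt_continuous; intros x Hx.
rewrite Rmin_left, Rmax_right in Hx by lra.
destruct (closed x y) as (px & k & qy & HP & HQ); [lra|lra|].
exact (proj1 (differentiable_pt_lim_continuous _ _ _ _ _ HP)).
Qed.

Lemma ex_RInt_slice_y (x l r : R) :
  c <= l <= r -> r <= d -> a <= x <= b -> ex_RInt (fun y => Q x y) l r.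
Proof.
intros; apply @ex_RInt_continuous; intros y Hy.
rewrite Rmin_left, Rmax_right in Hy by lra.
destruct (closed x y) as (px & k & qy & HP & HQ); [lra|lra|].
exact (proj2 (differentiable_pt_lim_continuous _ _ _ _ _ HQ)).
Qed.

Lemma boundary_int_edges (a' b' c' d' : R) :
  a <= a' <= b' -> b' <= b -> c <= c' <= d' -> d' <= d ->
  boundary_int P Q a' b' c' d' =
  RInt (fun x => P x c') a' b' - RInt (fun x => P x d') a' b' +
  (RInt (fun y => Q b' y) c' d' - RInt (fun y => Q a' y) c' d').
Proof.
intros; unfold boundary_int.
rewrite (RInt_minus_R (fun x => P x c') (fun x => P x d')) by (apply ex_RInt_slice_x; lra).
rewrite (RInt_minus_R (fun y => Q b' y) (fun y => Q a' y)) by (apply ex_RInt_slice_y; lra).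
reflexivity.
Qed.

(** Each inner edge is traversed twice, in opposite directions, and cancels. *)
Lemma boundary_int_split (a' b' c' d' p q : R) :
  a <= a' <= p -> p <= b' <= b -> c <= c' <= q -> q <= d' <= d ->
  boundary_int P Q a' b' c' d' =
  boundary_int P Q a' p c' q + boundary_int P Q p b' c' q +
  boundary_int P Q a' p q d' + boundary_int P Q p b' q d'.
Proof.
intros; rewrite !boundary_int_edges by lra.
rewrite (RInt_Chasles_R (fun x => P x c') a' p b'),
  (RInt_Chasles_R (fun x => P x d') a' p b') by (apply ex_RInt_slice_x; lra).
rewrite (RInt_Chasles_R (fun y => Q a' y) c' q d'),
  (RInt_Chasles_R (fun y => Q b' y) c' q d') by (apply ex_RInt_slice_y; lra).
ring.
Qed.

(** The affine parts of [P] and [Q] at [(x, y)] contribute nothing, the form being closed. The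
    errors are at most [eps * S] on a boundary of length [2 * S]. *)
Lemma boundary_int_local (x y eps : R) :
  a <= x <= b -> c <= y <= d -> 0 < eps ->
  exists delta, 0 < delta /\ forall a' b' c' d',
    a <= a' <= x -> x <= b' <= b -> c <= c' <= y -> y <= d' <= d ->
    b' - a' < delta -> d' - c' < delta ->
    Rabs (boundary_int P Q a' b' c' d') <= 2 * eps * (b' - a' + (d' - c')) ^ 2.
Proof.
intros Hx Hy He.
destruct (closed x y Hx Hy) as (px & k & qy & HP & HQ).
destruct (HP (mkposreal _ He)) as [d1 H1].
destruct (HQ (mkposreal _ He)) as [d2 H2]. simpl in H1, H2.
exists (Rmin d1 d2); split; [apply Rmin_pos; apply cond_pos|].
intros a' b' c' d' A1 A2 A3 A4 L1 L2.
set (S := b' - a' + (d' - c')).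
pose proof (Rmin_l d1 d2); pose proof (Rmin_r d1 d2).
assert (E1 : forall u v, a' <= u <= b' -> c' <= v <= d' ->
  Rabs (P u v - P x y - (px * (u - x) + k * (v - y))) <= eps * S).
{ intros u v Hu Hv. eapply Rle_trans; [apply H1; apply Rabs_def1; lra|].
  apply Rmult_le_compat_l; [lra|]. apply Rmax_lub; apply Rabs_le; unfold S; lra. }
assert (E2 : forall u v, a' <= u <= b' -> c' <= v <= d' ->
  Rabs (Q u v - Q x y - (k * (u - x) + qy * (v - y))) <= eps * S).
{ intros u v Hu Hv. eapply Rle_trans; [apply H2; apply Rabs_def1; lra|].
  apply Rmult_le_compat_l; [lra|]. apply Rmax_lub; apply Rabs_le; unfold S; lra. }
(* Between opposite edges the [px] terms cancel and only [k * (c' - d')] is left. Its integral is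
   the opposite of that of the term subtracted in [F2]. *)
assert (F1 : Rabs (RInt (fun u => (P u c' - P u d') - k * (c' - d')) a' b') <= (b' - a') * (2 * (eps * S))).
{ apply abs_RInt_le_const; [lra| |].
  - apply @ex_RInt_minus; [apply @ex_RInt_minus; apply ex_RInt_slice_x; lra | apply ex_RInt_const].
  - intros u Hu.
    pose proof (E1 u c' Hu ltac:(lra)) as U; pose proof (E1 u d' Hu ltac:(lra)) as V.
    apply Rabs_le_between in U; apply Rabs_le_between in V. apply Rabs_le; lra. }
assert (F2 : Rabs (RInt (fun v => (Q b' v - Q a' v) - k * (b' - a')) c' d') <= (d' - c') * (2 * (eps * S))).
{ apply abs_RInt_le_const; [lra| |].
  - apply @ex_RInt_minus; [apply @ex_RInt_minus; apply ex_RInt_slice_y; lra | apply ex_RInt_const].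
  - intros u Hu.
    pose proof (E2 b' u ltac:(lra) Hu) as U; pose proof (E2 a' u ltac:(lra) Hu) as V.
    apply Rabs_le_between in U; apply Rabs_le_between in V. apply Rabs_le; lra. }
rewrite (RInt_minus_R (fun u => P u c' - P u d') (fun _ => k * (c' - d'))) in F1;
  [|apply @ex_RInt_minus; apply ex_RInt_slice_x; lra | apply ex_RInt_const].
rewrite (RInt_minus_R (fun v => Q b' v - Q a' v) (fun _ => k * (b' - a'))) in F2;
  [|apply @ex_RInt_minus; apply ex_RInt_slice_y; lra | apply ex_RInt_const].
rewrite RInt_const in F1, F2; unfold scal in F1, F2; simpl in F1, F2; unfold mult in F1, F2; simpl in F1, F2.
unfold boundary_int.
apply Rabs_le_between in F1; apply Rabs_le_between in F2.
apply Rabs_le. unfold S in *. lra.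
Qed.

(* Goursat's lemma for a closed form [P dx + Q dy] with merely differentiable
   coefficients; [|boundary_int| > 2 eps (width + height)^2] is inherited by one
   of the four quarters. *)
Lemma boundary_int_closed : a <= b -> c <= d -> boundary_int P Q a b c d = 0.
Proof.
intros Hab Hcd.
apply NNPP; intros N.
apply Rabs_pos_lt in N. set (Phi := Rabs _) in N.
set (S := b - a + (d - c)).
assert (HS : 0 <= S ^ 2) by apply pow2_ge_0.
(* Small enough that [2 * eps * S ^ 2 < Phi], so the whole rectangle is bad; the [+ 1] covers a
   degenerate rectangle. *)
set (eps := Phi / (4 * (S ^ 2 + 1))).
assert (He : 0 < eps) by (apply Rdiv_lt_0_compat; lra).
assert (HPhi : 4 * (S ^ 2 + 1) * eps = Phi) by (unfold eps; field; lra).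
pose (B := fun a' b' c' d' => a <= a' /\ b' <= b /\ c <= c' /\ d' <= d /\
   2 * eps * (b' - a' + (d' - c')) ^ 2 < Rabs (boundary_int P Q a' b' c' d')).
destruct (quadrisection B a b c d Hab Hcd) as (x & y & Hx & Hy & Hsmall).
- unfold B; repeat split; try lra. fold Phi S. pose proof (Rmult_le_pos _ _ HS (Rlt_le _ _ He)). lra.
- intros a' b' c' d' H1 H2 (B1 & B2 & B3 & B4 & B5) p q.
  assert (Hp : a' <= p <= b') by (unfold p; lra).
  assert (Hq : c' <= q <= d') by (unfold q; lra).
  rewrite (boundary_int_split a' b' c' d' p q) in B5 by lra.
  apply NNPP; intros NB. apply not_or_and in NB as [N1 NB].
  apply not_or_and in NB as [N2 NB]. apply not_or_and in NB as [N3 N4].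
  (* Halving both sides divides the squared bound by 4, so four good quarters would add up to a good
     rectangle. *)
  assert (K : forall l r l2 r2, a <= l -> r <= b -> c <= l2 -> r2 <= d ->
    r - l = (b' - a') / 2 -> r2 - l2 = (d' - c') / 2 -> ~ B l r l2 r2 ->
    Rabs (boundary_int P Q l r l2 r2) <= 2 * eps * ((b' - a' + (d' - c')) ^ 2 / 4)).
  { intros l r l2 r2 K1 K2 K3 K4 K5 K6 NBad. apply Rnot_lt_le; intros C.
    apply NBad; unfold B; repeat split; auto.
    rewrite K5, K6. eapply Rle_lt_trans; [|exact C]. right; field. }
  apply K in N1; apply K in N2; apply K in N3; apply K in N4; try (unfold p, q in *; lra).
  revert B5. apply Rle_not_lt.
  apply Rabs_le_between in N1; apply Rabs_le_between in N2; apply Rabs_le_between in N3; apply Rabs_le_between in N4.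
  apply Rabs_le; lra.
- destruct (boundary_int_local x y eps Hx Hy He) as (delta & Hd & Hloc).
  destruct (Hsmall delta Hd) as (a' & b' & c' & d' & (B1 & B2 & B3 & B4 & B5) & K1 & K2 & K3 & K4 & K5 & K6).
  specialize (Hloc a' b' c' d'). lra.
Qed.

End Rectangle.

(** * Calculus of differentials in two real variables *)

Lemma differentiable_pt_lim_plus (f g : R -> R -> R) (x y fx fy gx gy : R) :
  differentiable_pt_lim f x y fx fy -> differentiable_pt_lim g x y gx gy ->
  differentiable_pt_lim (fun u v => f u v + g u v) x y (fx + gx) (fy + gy).
Proof.
intros Hf Hg.
apply filterdiff_differentiable_pt_lim in Hf; apply filterdiff_differentiable_pt_lim in Hg.
apply (filterdiff_differentiable_pt_lim (fun u v => f u v + g u v)).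
eapply filterdiff_ext_lin; [apply (filterdiff_plus_fct _ _ _ _ Hf Hg)|].
intros [u v]; unfold plus; simpl; ring.
Qed.

Lemma differentiable_pt_lim_mult (f g : R -> R -> R) (x y fx fy gx gy : R) :
  differentiable_pt_lim f x y fx fy -> differentiable_pt_lim g x y gx gy ->
  differentiable_pt_lim (fun u v => f u v * g u v) x y
    (fx * g x y + f x y * gx) (fy * g x y + f x y * gy).
Proof.
intros Hf Hg.
apply filterdiff_differentiable_pt_lim in Hf; apply filterdiff_differentiable_pt_lim in Hg.
apply (filterdiff_differentiable_pt_lim (fun u v => f u v * g u v)).
eapply filterdiff_ext_lin.
- apply (filterdiff_mult_fct (fun z : R * R => f (fst z) (snd z)) (fun z => g (fst z) (snd z)));
    [exact Rmult_comm | exact Hf | exact Hg].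
- intros [u v]; unfold plus, mult; simpl; ring.
Qed.

Lemma differentiable_pt_lim_swap (f : R -> R -> R) (x y lx ly : R) :
  differentiable_pt_lim f x y lx ly -> differentiable_pt_lim (fun u v => f v u) y x ly lx.
Proof.
intros H eps; destruct (H eps) as [delta Hd]; exists delta; intros u v Hu Hv.
rewrite (Rplus_comm (ly * _)), (Rmax_comm (Rabs (u - y))); auto.
Qed.

Lemma differentiable_pt_lim_fst (f : R -> R) (x y l : R) :
  is_derive f x l -> differentiable_pt_lim (fun u _ => f u) x y l 0.
Proof. intros H; apply differentiable_pt_lim_proj1_0, is_derive_Reals, H. Qed.

Lemma differentiable_pt_lim_snd (f : R -> R) (x y l : R) :
  is_derive f y l -> differentiable_pt_lim (fun _ v => f v) x y 0 l.
Proof. intros H; now apply differentiable_pt_lim_swap, (differentiable_pt_lim_fst f y x l). Qed.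

Lemma differentiable_pt_lim_eq (f : R -> R -> R) (x y lx ly lx' ly' : R) :
  differentiable_pt_lim f x y lx ly -> lx = lx' -> ly = ly' ->
  differentiable_pt_lim f x y lx' ly'.
Proof. now intros H -> ->. Qed.

(** * The difference quotient in polar coordinates *)

Definition circle_pt (s : C) (r th : R) : C := (Re s + r * cos th, Im s + r * sin th).

Definition unit_dir (th : R) : C := (cos th, sin th).

(* Real and imaginary parts of [(f z - f s) / (z - s)] at [z = s + r e^(i th)];
   the imaginary part carries one more factor [/ r], so that
   [quot_im dr + quot_re dth] is a closed form. *)
Definition quot_re (f : C -> C) (s : C) (r th : R) : R :=
  Re ((f (circle_pt s r th) - f s) * Cconj (unit_dir th)) * / r.

Definition quot_im (f : C -> C) (s : C) (r th : R) : R :=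
  Im ((f (circle_pt s r th) - f s) * Cconj (unit_dir th)) * / r * / r.

(** With [q = (f z - f s) / (z - s)] and [dz / (z - s) = dr / r + i dth], the form is the imaginary
    part of the holomorphic form [q dz / (z - s)]. *)
Lemma quot_closed (f : C -> C) (s : C) (r th : R) :
  0 < r -> @ex_derive C_AbsRing C_NormedModule f (circle_pt s r th) ->
  exists px k qy, differentiable_pt_lim (quot_im f s) r th px k /\
    differentiable_pt_lim (quot_re f s) r th k qy.
Proof.
intros Hr [l Hl]. apply Cauchy_Riemann in Hl as [HU HV].
assert (Dcos : differentiable_pt_lim (fun _ v => cos v) r th 0 (- sin th))
  by (apply differentiable_pt_lim_snd; auto_derive; [trivial|ring]).
assert (Dsin : differentiable_pt_lim (fun _ v => sin v) r th 0 (cos th))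
  by (apply differentiable_pt_lim_snd; auto_derive; [trivial|ring]).
assert (Dnsin : differentiable_pt_lim (fun _ v => - sin v) r th 0 (- cos th))
  by (apply (differentiable_pt_lim_snd (fun v => - sin v)); auto_derive; [trivial|ring]).
assert (Dr : differentiable_pt_lim (fun u _ => u) r th 1 0)
  by (apply (differentiable_pt_lim_fst (fun u => u)); apply @is_derive_id).
assert (Dinv : differentiable_pt_lim (fun u _ => / u) r th (- / r ^ 2) 0)
  by (apply (differentiable_pt_lim_fst (fun u => / u)); auto_derive; [lra|field; lra]).
assert (Dc : forall c, differentiable_pt_lim (fun _ _ => c) r th 0 0)
  by (intros c; apply (differentiable_pt_lim_fst (fun _ => c)); apply @is_derive_const).
assert (DX := differentiable_pt_lim_plus _ _ _ _ _ _ _ _ (Dc (Re s))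
  (differentiable_pt_lim_mult _ _ _ _ _ _ _ _ Dr Dcos)).
assert (DY := differentiable_pt_lim_plus _ _ _ _ _ _ _ _ (Dc (Im s))
  (differentiable_pt_lim_mult _ _ _ _ _ _ _ _ Dr Dsin)).
assert (DA := differentiable_pt_lim_plus _ _ _ _ _ _ _ _
  (differentiable_pt_lim_comp _ _ _ _ _ _ _ _ _ _ _ HU DX DY) (Dc (- Re (f s)))).
assert (DB := differentiable_pt_lim_plus _ _ _ _ _ _ _ _
  (differentiable_pt_lim_comp _ _ _ _ _ _ _ _ _ _ _ HV DX DY) (Dc (- Im (f s)))).
assert (DQ := differentiable_pt_lim_mult _ _ _ _ _ _ _ _
  (differentiable_pt_lim_plus _ _ _ _ _ _ _ _
    (differentiable_pt_lim_mult _ _ _ _ _ _ _ _ DA Dcos)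
    (differentiable_pt_lim_mult _ _ _ _ _ _ _ _ DB Dsin)) Dinv).
assert (DP := differentiable_pt_lim_mult _ _ _ _ _ _ _ _
  (differentiable_pt_lim_mult _ _ _ _ _ _ _ _
  (differentiable_pt_lim_plus _ _ _ _ _ _ _ _
    (differentiable_pt_lim_mult _ _ _ _ _ _ _ _ DA Dnsin)
    (differentiable_pt_lim_mult _ _ _ _ _ _ _ _ DB Dcos)) Dinv) Dinv).
cbv beta in DQ, DP.
do 3 eexists; split.
- eapply differentiable_pt_lim_ext; [|exact DP].
  apply locally_2d_forall; intros u v.
  unfold quot_im, circle_pt, unit_dir; simpl; unfold Re, Im; ring.
- eapply differentiable_pt_lim_eq; [eapply differentiable_pt_lim_ext; [|exact DQ]| |reflexivity].
  + apply locally_2d_forall; intros u v.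
    unfold quot_re, circle_pt, unit_dir; simpl; unfold Re, Im; ring.
  (* Equality of the mixed derivatives; the Cauchy-Riemann equations enter through the common [l] of
     [HU] and [HV]. *)
  + field; lra.
Qed.

Lemma Cmod_unit_dir (th : R) : Cmod (unit_dir th) = 1.
Proof.
unfold Cmod, unit_dir; simpl fst; simpl snd.
replace (cos th ^ 2 + sin th ^ 2) with 1; [apply sqrt_1|].
pose proof (sin2_cos2 th) as H; unfold Rsqr in H; lra.
Qed.

Lemma circle_pt_sub (s : C) (r th : R) : (circle_pt s r th - s)%C = (r * unit_dir th)%C.
Proof.
destruct s; unfold circle_pt, unit_dir, Cminus, Cplus, Copp, Cmult, RtoC, Re, Im; simpl; f_equal; ring.
Qed.

(** * Cauchy's estimate *)

Lemma Re_derive_le (f : C -> C) (s l : C) (r K : R) :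
  0 < r -> @is_derive C_AbsRing C_NormedModule f s l ->
  (forall z, Cmod (z - s) <= r -> @ex_derive C_AbsRing C_NormedModule f z) ->
  (forall z, Cmod (z - s) <= r -> Cmod (f z - f s) <= K) ->
  Re l <= K / r.
Proof.
intros Hr Hl Hex HK.
assert (HPI := PI_RGT_0).
assert (Hcirc : forall r' th, 0 < r' -> Cmod (circle_pt s r' th - s) = r').
{ intros r' th Hr'. rewrite circle_pt_sub, Cmod_mult, Cmod_unit_dir, Cmod_R, Rabs_right; lra. }
apply Rnot_lt_le; intros N.
(* Half of the supposed gap: [quot_re] is at most [Re l - 2 * eps] on the circle of radius [r], but
   at least [Re l - eps] on a small one. *)
set (eps := (Re l - K / r) / 2).
assert (He : 0 < eps) by (unfold eps; lra).
destruct (is_derive_C_small_o f s l (mkposreal _ He) Hl) as [delta Hd].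
simpl in Hd.
set (r' := Rmin r (delta / 2)).
assert (Hr' : 0 < r' <= r).
{ split; [apply Rmin_pos; destruct delta; simpl; lra | apply Rmin_l]. }
assert (Hr'd : r' < delta).
{ eapply Rle_lt_trans; [apply Rmin_r|]; destruct delta; simpl; lra. }
assert (Hclosed : forall x y, r' <= x <= r -> 0 <= y <= 2 * PI ->
  exists px k qy, differentiable_pt_lim (quot_im f s) x y px k /\
    differentiable_pt_lim (quot_re f s) x y k qy).
{ intros x y Hx _. apply quot_closed; [lra|]. apply Hex. rewrite Hcirc; lra. }
assert (G := boundary_int_closed _ _ r' r 0 (2 * PI) Hclosed ltac:(lra) ltac:(lra)).
unfold boundary_int in G.
(* The edges at angles [0] and [2 * PI] are the same radial segment, so only the two circular
   integrals remain in [G]. *)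
rewrite (RInt_ext _ (fun _ => 0)) in G.
2:{ intros x _. unfold quot_im, circle_pt, unit_dir. rewrite cos_2PI, sin_2PI, cos_0, sin_0. apply Rminus_diag. }
rewrite RInt_const in G.
assert (B1 : forall th, quot_re f s r th <= K / r).
{ intros th. unfold quot_re, Rdiv. apply Rmult_le_compat_r; [left; now apply Rinv_0_lt_compat|].
  eapply Rle_trans; [apply Rle_abs|]. eapply Rle_trans; [apply re_le_Cmod|].
  rewrite Cmod_mult, Cmod_conj, Cmod_unit_dir, Rmult_1_r.
  apply HK. rewrite Hcirc; lra. }
assert (B2 : forall th, Re l - eps <= quot_re f s r' th).
{ intros th. specialize (Hd (circle_pt s r' th)).
  rewrite (Hcirc _ _ (proj1 Hr')) in Hd. specialize (Hd Hr'd).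
  rewrite circle_pt_sub in Hd. unfold quot_re.
  apply Rmult_le_reg_r with r'; [lra|].
  rewrite Rmult_assoc, Rinv_l, Rmult_1_r by lra.
  assert (D := re_le_Cmod ((f (circle_pt s r' th) - f s - r' * unit_dir th * l) * Cconj (unit_dir th))).
  rewrite Cmod_mult, Cmod_conj, Cmod_unit_dir, Rmult_1_r in D.
  (* The direction times its conjugate is 1, so the linear part contributes exactly [r' * Re l]. *)
  assert (E : Re ((f (circle_pt s r' th) - f s - r' * unit_dir th * l) * Cconj (unit_dir th)) =
    Re ((f (circle_pt s r' th) - f s) * Cconj (unit_dir th)) - r' * Re l).
  { transitivity (Re ((f (circle_pt s r' th) - f s) * Cconj (unit_dir th))
      - r' * Re l * (Rsqr (sin th) + Rsqr (cos th))).
    - unfold unit_dir, Rsqr; simpl; unfold Re, Im; ring.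
    - rewrite sin2_cos2, Rmult_1_r; reflexivity. }
  rewrite E in D. pose proof (Rle_trans _ _ _ D Hd) as D2.
  apply Rabs_le_between in D2. lra. }
assert (L : RInt (fun y => quot_re f s r y - quot_re f s r' y) 0 (2 * PI) <=
            RInt (fun _ => - eps) 0 (2 * PI)).
{ apply RInt_le; [lra| |apply ex_RInt_const|].
  - apply @ex_RInt_minus; apply (ex_RInt_slice_y (quot_im f s) _ r' r 0 (2 * PI) Hclosed); lra.
  - intros th _. specialize (B1 th); specialize (B2 th). unfold eps in *. lra. }
rewrite RInt_const in L.
unfold scal in G, L; simpl in G, L; unfold mult in G, L; simpl in G, L.
assert (0 < (2 * PI) * eps) by (apply Rmult_lt_0_compat; lra).
lra.
Qed.

Lemma Cauchy_estimate (f : C -> C) (s l : C) (r K : R) :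
  0 < r -> @is_derive C_AbsRing C_NormedModule f s l ->
  (forall z, Cmod (z - s) <= r -> @ex_derive C_AbsRing C_NormedModule f z) ->
  (forall z, Cmod (z - s) <= r -> Cmod (f z - f s) <= K) ->
  Cmod l <= K / r.
Proof.
intros Hr Hl Hex HK.
assert (HK0 : 0 <= K).
{ eapply Rle_trans; [apply Cmod_ge_0 | apply (HK s)].
  replace (s - s)%C with (RtoC 0) by ring. rewrite Cmod_0; lra. }
destruct (Ceq_dec l 0) as [->|Hl0].
{ rewrite Cmod_0. apply Rmult_le_pos; [lra|left; now apply Rinv_0_lt_compat]. }
assert (Hm : 0 < Cmod l) by now apply Cmod_gt_0.
(* A rotation making the derivative of [c * f] the positive real [Cmod l], so that the bound on real
   parts suffices. *)
pose (c := (Cconj l / Cmod l)%C).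
assert (Hc : Cmod c = 1).
{ unfold c. rewrite Cmod_div, Cmod_conj, Cmod_R, Rabs_right.
  - field; lra.
  - lra.
  - intros E; injection E; lra. }
assert (Hcl : (c * l)%C = RtoC (Cmod l)).
{ unfold c. replace (Cconj l / Cmod l * l)%C with (l * Cconj l / Cmod l)%C
    by (field; intros E; injection E; lra).
  rewrite <- Cmod2_conj, RtoC_pow. field. intros E; injection E; lra. }
assert (Dc : forall z m, @is_derive C_AbsRing C_NormedModule f z m ->
   @is_derive C_AbsRing C_NormedModule (fun w => c * f w)%C z (c * m)%C).
{ intros z m H. apply is_derive_C_iff; apply is_derive_C_iff in H.
  pose proof (is_derive_mult _ _ _ _ _ (@is_derive_const C_AbsRing (AbsRing_NormedModule C_AbsRing) c z) H Cmult_comm) as D.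
  replace (c * m)%C with (0 * f z + c * m)%C by ring. exact D. }
change (Re (RtoC (Cmod l)) <= K / r); rewrite <- Hcl.
apply (Re_derive_le (fun w => c * f w)%C s); auto.
- intros z Hz; destruct (Hex z Hz) as [m H]; exists (c * m)%C; auto.
- intros z Hz. replace (c * f z - c * f s)%C with (c * (f z - f s))%C by ring.
  rewrite Cmod_mult, Hc, Rmult_1_l; auto.
Qed.

(** * Bloch functions and their powers *)

(** Go from [s] to [w] by a horizontal and then a vertical segment, staying where the real part is
    at least [Re s / 2] and so the derivative at most [2 * M / Re s]. Each leg changes [Re u] and
    [Im u] by at most [M]; passing to the modulus costs another factor 2. *)
Lemma Bloch_oscillation (u : C -> C) (M : R) (s w : C) :
  analytic_on_right_half_plane u ->
  (forall sigma t, 0 < sigma -> sigma * Cmod (C_derive u (sigma, t)) <= M) ->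
  0 < Re s -> Cmod (w - s) <= Re s / 2 -> Cmod (u w - u s) <= 4 * M.
Proof.
intros Hu HM Hs Hw.
assert (Hx : Rabs (Re w - Re s) <= Re s / 2).
{ eapply Rle_trans; [exact (re_le_Cmod (w - s))|exact Hw]. }
assert (Hy : Rabs (Im w - Im s) <= Re s / 2).
{ eapply Rle_trans; [|exact Hw].
  eapply Rle_trans; [|exact (Rmax_Cmod (w - s)%C)]. apply Rmax_r. }
set (D := 2 * M / Re s).
assert (HD : forall x y, Re s / 2 <= x -> Cmod (C_derive u (x, y)) <= D).
{ intros x y Hxy. unfold D. apply Rle_div_r; [lra|].
  assert (H := HM x y ltac:(lra)). pose proof (Cmod_ge_0 (C_derive u (x, y))). nra. }
assert (HDpos : 0 <= D).
{ eapply Rle_trans; [apply Cmod_ge_0 | apply (HD (Re s) 0); lra]. }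
assert (CR : forall x y, Re s / 2 <= x ->
  let l := C_derive u (x, y) in
  differentiable_pt_lim (fun p q => Re (u (p, q))) x y (Re l) (- Im l) /\
  differentiable_pt_lim (fun p q => Im (u (p, q))) x y (Im l) (Re l) /\
  Rabs (Re l) <= D /\ Rabs (- Im l) <= D /\ Rabs (Im l) <= D).
{ intros x y Hxy l.
  assert (Hl : @is_derive C_AbsRing C_NormedModule u (x, y) l).
  { apply C_derive_correct; [exact s | apply Hu; simpl; lra]. }
  apply Cauchy_Riemann in Hl as [H1 H2]. rewrite Rabs_Ropp.
  pose proof (HD x y Hxy) as H3; fold l in H3.
  pose proof (Rmax_Cmod l) as H4.
  pose proof (Rmax_l (Rabs (fst l)) (Rabs (snd l))).
  pose proof (Rmax_r (Rabs (fst l)) (Rabs (snd l))).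
  unfold Re, Im in *. repeat split; auto; lra. }
assert (Hsx : forall x, Rabs (x - Re s) <= Rabs (Re w - Re s) -> Re s / 2 <= x).
{ intros x Hxx. pose proof (Rle_trans _ _ _ Hxx Hx) as H.
  apply Rabs_le_between in H; lra. }
assert (Hwx : Re s / 2 <= Re w) by (apply Hsx; lra).
assert (HDs : D * (Re s / 2) = M) by (unfold D; field; lra).
assert (V1 : Rabs (Re (u (Re w, Im s)) - Re (u (Re s, Im s))) <= D * Rabs (Re w - Re s)).
{ apply (bounded_variation (fun x => Re (u (x, Im s))) (fun x => Re (C_derive u (x, Im s)))).
  intros x Hxx. destruct (CR x (Im s) (Hsx x Hxx)) as (H1 & H2 & H3 & H4 & H5).
  split; [apply (differentiable_pt_lim_is_derive _ _ _ _ _ H1) | exact H3]. }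
assert (V2 : Rabs (Im (u (Re w, Im s)) - Im (u (Re s, Im s))) <= D * Rabs (Re w - Re s)).
{ apply (bounded_variation (fun x => Im (u (x, Im s))) (fun x => Im (C_derive u (x, Im s)))).
  intros x Hxx. destruct (CR x (Im s) (Hsx x Hxx)) as (H1 & H2 & H3 & H4 & H5).
  split; [apply (differentiable_pt_lim_is_derive _ _ _ _ _ H2) | exact H5]. }
assert (V3 : Rabs (Re (u (Re w, Im w)) - Re (u (Re w, Im s))) <= D * Rabs (Im w - Im s)).
{ apply (bounded_variation (fun y => Re (u (Re w, y))) (fun y => - Im (C_derive u (Re w, y)))).
  intros y _. destruct (CR (Re w) y Hwx) as (H1 & H2 & H3 & H4 & H5).
  split; [apply (differentiable_pt_lim_is_derive _ _ _ _ _ H1) | exact H4]. }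
assert (V4 : Rabs (Im (u (Re w, Im w)) - Im (u (Re w, Im s))) <= D * Rabs (Im w - Im s)).
{ apply (bounded_variation (fun y => Im (u (Re w, y))) (fun y => Re (C_derive u (Re w, y)))).
  intros y _. destruct (CR (Re w) y Hwx) as (H1 & H2 & H3 & H4 & H5).
  split; [apply (differentiable_pt_lim_is_derive _ _ _ _ _ H2) | exact H3]. }
assert (Sx := Rmult_le_compat_l D _ _ HDpos Hx).
assert (Sy := Rmult_le_compat_l D _ _ HDpos Hy).
rewrite HDs in Sx, Sy.
assert (S2 : sqrt 2 <= 2).
{ rewrite <- (sqrt_square 2) at 2; [apply sqrt_le_1|]; lra. }
assert (Es : (Re s, Im s) = s) by (destruct s; reflexivity).
assert (Ew : (Re w, Im w) = w) by (destruct w; reflexivity).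
rewrite Es in V1, V2. rewrite Ew in V3, V4.
apply Rabs_le_between in V1; apply Rabs_le_between in V2;
  apply Rabs_le_between in V3; apply Rabs_le_between in V4.
assert (X : Rmax (Rabs (fst (u w - u s)%C)) (Rabs (snd (u w - u s)%C)) <= 2 * M).
{ unfold Re, Im in *.
  apply Rmax_lub; apply Rabs_le; simpl; lra. }
eapply Rle_trans; [apply Cmod_2Rmax|].
eapply Rle_trans; [apply Rmult_le_compat; [apply sqrt_pos| |exact S2|exact X]|lra].
eapply Rle_trans; [apply Rabs_pos | apply Rmax_l].
Qed.

Lemma Bloch_root_derive (f : C -> C) (n : nat) (M : R) (s : C) :
  (1 <= n)%nat -> analytic_on_right_half_plane f ->
  analytic_on_right_half_plane (fun z => Cpow (f z) n) ->
  (forall sigma t, 0 < sigma ->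
    sigma * Cmod (C_derive (fun z => Cpow (f z) n) (sigma, t)) <= M) ->
  0 < Re s -> Cmod (f s) <= 1 -> Re s * Cmod (C_derive f s) <= 4 + 8 * M.
Proof.
intros Hn Hf Hfn HM Hs H1.
assert (HM0 : 0 <= M).
{ eapply Rle_trans; [|apply (HM 1 0); lra]. rewrite Rmult_1_l; apply Cmod_ge_0. }
assert (Hbound : forall w, Cmod (w - s) <= Re s / 2 -> Cmod (f w) <= 1 + 4 * M).
{ intros w Hw.
  assert (Hosc := Bloch_oscillation _ M s w Hfn HM Hs Hw).
  assert (Hpow : Cmod (f w) ^ n <= 1 + 4 * M).
  { rewrite <- Cmod_pow.
    replace (f w ^ n)%C with (f s ^ n + (f w ^ n - f s ^ n))%C by ring.
    eapply Rle_trans; [apply Cmod_triangle|]. apply Rplus_le_compat; [|exact Hosc].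
    rewrite Cmod_pow, <- (pow1 n). apply pow_incr; split; [apply Cmod_ge_0|exact H1]. }
  (* Where the modulus exceeds 1 it is at most its [n]-th power, since [1 <= n]; elsewhere the bound
     is trivial. *)
  destruct (Rle_lt_dec (Cmod (f w)) 1) as [L|L]; [lra|].
  eapply Rle_trans; [|exact Hpow].
  rewrite <- (pow_1 (Cmod (f w))) at 1. apply Rle_pow; [lra|exact Hn]. }
(* The oscillation bound is [1 + 4 * M] for [f z] plus 1 for [f s]; the radius [Re s / 2] doubles
   it. *)
assert (E : Cmod (C_derive f s) <= (2 + 4 * M) / (Re s / 2)).
{ apply (Cauchy_estimate f s); [lra| | |].
  - apply C_derive_correct; [exact s | now apply Hf].
  - intros z Hz. apply Hf.
    pose proof (Rle_trans _ _ _ (re_le_Cmod (z - s)) Hz) as R1.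
    apply Rabs_le_between in R1. destruct z, s; unfold Re in *; simpl in *; lra.
  - intros z Hz. unfold Cminus. eapply Rle_trans; [apply Cmod_triangle|].
    rewrite Cmod_opp. specialize (Hbound z Hz). lra. }
apply (Rmult_le_compat_l (Re s)) in E; [|lra].
eapply Rle_trans; [exact E|]. right; field; lra.
Qed.

Lemma Bloch_pow_le (f : C -> C) (m n : nat) :
  (1 <= m <= n)%nat -> analytic_on_right_half_plane f ->
  Bloch (fun s => Cpow (f s) n) -> Bloch (fun s => Cpow (f s) m).
Proof.
intros Hmn Hf [Hfn [M HM]].
assert (HM0 : 0 <= M).
{ eapply Rle_trans; [|apply (HM 1 0); lra]. rewrite Rmult_1_l; apply Cmod_ge_0. }
assert (Hder : forall k s, 0 < Re s ->
  @is_derive C_AbsRing C_NormedModule (fun z => Cpow (f z) k) s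
    (INR k * Cpow (f s) (pred k) * C_derive f s)%C).
{ intros k s Hs. apply is_derive_Cpow, C_derive_correct; [exact s | now apply Hf]. }
assert (Hmod : forall k sigma t, 0 < sigma ->
  sigma * Cmod (C_derive (fun z => Cpow (f z) k) (sigma, t)) =
  INR k * (Cmod (f (sigma, t)) ^ pred k * (sigma * Cmod (C_derive f (sigma, t))))).
{ intros k sigma t Hs. rewrite (is_C_derive_unique (fun z : C => Cpow (f z) k) _ _ (Hder k (sigma, t) Hs)).
  rewrite !Cmod_mult, Cmod_pow, Cmod_R, Rabs_right by (apply Rle_ge, pos_INR). ring. }
split; [intros s Hs; eexists; now apply Hder|].
(* The constant comes from the points with [Cmod (f z) <= 1]; at the others [M] itself suffices in
   place of [4 + 8 * M]. *)
exists (INR m * (4 + 8 * M)); intros sigma t Hs.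
rewrite Hmod by exact Hs. apply Rmult_le_compat_l; [apply pos_INR|].
set (z := (sigma, t)); set (A := sigma * Cmod (C_derive f z)).
assert (HA : 0 <= A) by (apply Rmult_le_pos; [lra|apply Cmod_ge_0]).
destruct (Rle_lt_dec (Cmod (f z)) 1) as [L|L].
- assert (HA2 : A <= 4 + 8 * M).
  { apply (Bloch_root_derive f n M z); auto; lia. }
  assert (Cmod (f z) ^ pred m <= 1).
  { rewrite <- (pow1 (pred m)). apply pow_incr; split; [apply Cmod_ge_0|exact L]. }
  eapply Rle_trans; [apply Rmult_le_compat_r; [exact HA | eassumption]|]. lra.
- specialize (HM sigma t Hs). rewrite Hmod in HM by exact Hs. fold z A in HM.
  assert (Hp : Cmod (f z) ^ pred m <= Cmod (f z) ^ pred n) by (apply Rle_pow; [lra|lia]).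
  assert (H1n : 1 <= INR n) by (apply (le_INR 1 n); lia).
  assert (HB : 0 <= Cmod (f z) ^ pred n * A).
  { apply Rmult_le_pos; [apply pow_le, Cmod_ge_0|exact HA]. }
  apply (Rmult_le_compat_r A) in Hp; [|exact HA].
  assert (1 * (Cmod (f z) ^ pred n * A) <= INR n * (Cmod (f z) ^ pred n * A)).
  { now apply Rmult_le_compat_r. }
  lra.
Qed.

Theorem theorem8p3 (d : nat) (a : nat -> C) (f : C -> C) (n : nat)
  (hd : (1 <= d)%nat) (hn : (1 <= n)%nat)
  (hD : dirichlet_class d a)
  (hf : analytic_extension a f)
  (hB : Bloch (fun s : C => Cpow (f s) n)) :
  forall m : nat, (1 <= m <= n)%nat -> Bloch (fun s : C => Cpow (f s) m).
Proof.
intros m Hm. exact (Bloch_pow_le f m n Hm (proj1 hf) hB).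
Qed.
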